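(* Let $(\mathcal{C},\Sigma,T)$ be a $\mathbb{Z}$-graded triangulated category satisfying the Standing Hypothesis described in the context, with Serre functor $F=\Sigma^d\circ T^{\mathfrak l}\circ\Phi$ and scalars $s,t\in k^\times$. Let $X\in\mathcal{C}$ be an object such that there exists an isomorphism $\phi\colon X\to\Phi(X)$. Then $$E(X)=\bigoplus_{i,j\in\mathbb{Z}}\operatorname{Hom}_{\mathcal C}(X,\Sigma^iT^jX),$$ with multiplication given by the graded composition $*$, is a bigraded Frobenius algebra. An associative nondegenerate bilinear form is defined on homogeneous elements $f,g\in E(X)$ of degrees $|g|=(i,j)$ and $|f|=(d-i,\mathfrak l-j)$ by $$(f,g)=\operatorname{Tr}_X(\phi*f*g)=\operatorname{Tr}_X\bigl(\Sigma^dT^{\mathfrak l}(\phi)\circ\Sigma^iT^j(f)\circ g\bigr),$$ and by $(f,g)=0$ if $|f|+|g|\neq(d,\mathfrak l)$. The corresponding Nakayama automorphism is given, for $g\in\operatorname{Hom}_{\mathcal C}(X,\Sigma^iT^jX)$, by $$g\longmapsto(-s)^it^j\,\phi^{-1}*\Phi(g)*\phi=(-s)^it^j\,\Sigma^iT^j(\phi)^{-1}\circ\Phi(g)\circ\phi .$$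
   Context: $k$ is an algebraically closed field and all categories and functors are $k$-linear; $(-)^*$ is the $k$-dual. $\mathcal{C}$ is Hom-finite if all Hom spaces are finite-dimensional. Graded composition: if $\Sigma,T$ are commuting automorphisms of $\mathcal C$ ($\Sigma T=T\Sigma$), put $\operatorname{Hom}^{i,j}(X,Y)=\operatorname{Hom}(X,\Sigma^iT^jY)$. For $f\in\operatorname{Hom}^{i,j}(X,Y)$ and $g\in\operatorname{Hom}^{p,q}(Y,Z)$, set $g*f=\Sigma^iT^j(g)\circ f\in\operatorname{Hom}^{i+p,j+q}(X,Z)$. Morphisms $X\to Y$ are viewed as having degree $(0,0)$. Serre functor: an autoequivalence $F$ of $\mathcal C$ with isomorphisms $\alpha_{X,Y}\colon\operatorname{Hom}(X,Y)\to\operatorname{Hom}(Y,FX)^*$ natural in $X$ and $Y$. The trace is $\operatorname{Tr}_X=\alpha_{X,X}(\operatorname{id}_X)\colon\operatorname{Hom}(X,FX)\to k$. For an automorphism $S$ of $\mathcal C$ and $\epsilon\in k^\times$, $\eta_\epsilon(S)\colon FS\to SF$ is the unique natural isomorphism $\eta$ satisfying $\operatorname{Tr}_X(S^{-1}(\eta_X\circ f))=\epsilon\operatorname{Tr}_{SX}(f)$ for all $X$ and all $f\colon SX\to FSX$. A graded functor $(U,\eta)$ of a triangulated category $(\mathcal C,\Sigma)$ (a functor $U$ with natural isomorphism $\eta\colon U\Sigma\to\Sigma U$) is exact if each exact triangle $X\xrightarrow{f}Y\xrightarrow{g}Z\xrightarrow{h}\Sigma X$ is sent to an exact triangle $UX\xrightarrow{Uf}UY\xrightarrow{Ug}UZ\xrightarrow{\eta_X\circ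 Uh}\Sigma UX$. The symbol $\mathbf 1$ denotes the identity (trivial) commutation. Standing Hypothesis. $\mathcal C$ is a Hom-finite $k$-linear triangulated category with translation automorphism $\Sigma$, and: (1) $\mathcal C$ has a Serre functor $F$, with fixed isomorphisms $\alpha_{X,Y}$; put $\eta=\eta_{-1}(\Sigma)\colon F\Sigma\to\Sigma F$ (which makes $F$ exact). (2) $T$ is an automorphism of $\mathcal C$ with $T\Sigma=\Sigma T$ and $(T,\mathbf 1_{T\Sigma})$ exact; put $\theta=\eta_1(T)\colon FT\to TF$. (3) $\Phi$ is an autoequivalence of $\mathcal C$ with $\Phi\Sigma=\Sigma\Phi$, $\Phi T=T\Phi$, $(\Phi,\mathbf 1_{\Phi\Sigma})$ exact, and $F=\Sigma^d\circ T^{\mathfrak l}\circ\Phi$ for some $d,\mathfrak l\in\mathbb Z$ (hence $F\Sigma=\Sigma F$, $FT=TF$ as functors). (4) $\eta=s\cdot\mathbf 1_{F\Sigma}$ and $\theta=t\cdot\mathbf 1_{FT}$ for some $s,t\in k^\times$. The functors $\Sigma,T,\Phi$ are silently commuted in formulas. Frobenius algebra (possibly infinite-dimensional): a $k$-algebra $E$ with an associative ($(ab,c)=(a,bc)$) nondegenerate bilinear form $(-,-)\colon E\times E\to k$ and an algebra automorphism $\mu$, called a Nakayama automorphism, with $(x,y)=(\mu(y),x)$ for all $x,y\in E$. *)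

(* Defs.v *)
Set Warnings "-notation-overridden,-ambiguous-paths,-notation-incompatible-prefix,-redundant-canonical-projection".
From HB Require Import structures.
From mathcomp Require Import all_boot all_order all_algebra.
From mathcomp Require Import boolp classical_sets functions cardinality fsbigop.
From mathcomp Require Import sesquilinear.

Set Implicit Arguments.
Unset Strict Implicit.
Unset Printing Implicit Defensive.

Import GRing.Theory.

Local Open Scope classical_set_scope.
Local Open Scope ring_scope.

(* Hom-finiteness is built in: Hom spaces are vectTypes. *)
Record lincat (k : fieldType) := LinCat {
  ob :> Type;
  hom : ob -> ob -> vectType k;
  idm : forall X, hom X X;
  comp : forall X Y Z, hom Y Z -> hom X Y -> hom X Z;
  comp_linl : forall X Y Z (f : hom X Y), linear (fun g : hom Y Z => comp g f);
  comp_linr : forall X Y Z (g : hom Y Z), linear (fun f : hom X Y => comp g f);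
  compA : forall X Y Z W (h : hom Z W) (g : hom Y Z) (f : hom X Y),
    comp h (comp g f) = comp (comp h g) f;
  comp1m : forall X Y (f : hom X Y), comp (idm Y) f = f;
  compm1 : forall X Y (f : hom X Y), comp f (idm X) = f
}.

Arguments hom {k C} : rename.
Arguments idm {k C} X : rename.
Arguments comp {k C X Y Z} g f : rename.

Notation "g \oc f" := (comp g f) (at level 40, left associativity).

Section Basics.
Variable k : fieldType.
Implicit Types C D E : lincat k.

Record iso C (X Y : C) := Iso {
  iso_hom :> hom X Y;
  iso_inv : hom Y X;
  iso_hK : iso_inv \oc iso_hom = idm X;
  iso_vK : iso_hom \oc iso_inv = idm Y
}.

Definition invertible C (X Y : C) (f : hom X Y) :=
  exists g : hom Y X, g \oc f = idm X /\ f \oc g = idm Y.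

Definition is_zero_ob C (Z : C) :=
  forall Y : C, (forall f : hom Y Z, f = 0) /\ (forall f : hom Z Y, f = 0).

Definition is_biproduct C (X Y Z : C) :=
  exists (i1 : hom X Z) (i2 : hom Y Z) (p1 : hom Z X) (p2 : hom Z Y),
    [/\ p1 \oc i1 = idm X, p2 \oc i2 = idm Y, p1 \oc i2 = 0, p2 \oc i1 = 0
      & i1 \oc p1 + i2 \oc p2 = idm Z].

Definition additive_cat C :=
  (exists Z : C, is_zero_ob Z) /\ (forall X Y : C, exists Z, is_biproduct X Y Z).

Record functor C D := Functor {
  fob :> C -> D;
  fmap : forall X Y : C, hom X Y -> hom (fob X) (fob Y);
  fmap_lin : forall X Y : C, linear (@fmap X Y);
  fmap1 : forall X : C, fmap (idm X) = idm (fob X);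
  fmapM : forall (X Y Z : C) (g : hom Y Z) (f : hom X Y),
    fmap (g \oc f) = fmap g \oc fmap f
}.
Arguments fmap {C D} F {X Y} f : rename.

Definition fid C : functor C C :=
  @Functor C C id (fun _ _ f => f)
    (fun _ _ _ _ _ => erefl) (fun _ => erefl) (fun _ _ _ _ _ => erefl).

Section Composition.
Variables (C D E : lincat k) (G : functor D E) (F : functor C D).

Fact fcomp_lin (X Y : C) : linear (fun f : hom X Y => fmap G (fmap F f)).
Proof. by move=> a f g; rewrite !fmap_lin. Qed.
Fact fcomp_1 (X : C) : fmap G (fmap F (idm X)) = idm (G (F X)).
Proof. by rewrite !fmap1. Qed.
Fact fcomp_M (X Y Z : C) (g : hom Y Z) (f : hom X Y) :
  fmap G (fmap F (g \oc f)) = fmap G (fmap F g) \oc fmap G (fmap F f).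
Proof. by rewrite !fmapM. Qed.

Definition fcomp : functor C E :=
  @Functor C E (fun X => G (F X)) (fun X Y f => fmap G (fmap F f))
    fcomp_lin fcomp_1 fcomp_M.

End Composition.

Section MapIso.
Variables (C D : lincat k) (F : functor C D) (X Y : C) (f : iso X Y).

Fact fmap_hK : fmap F (iso_inv f) \oc fmap F f = idm (F X).
Proof. by rewrite -fmapM iso_hK fmap1. Qed.
Fact fmap_vK : fmap F f \oc fmap F (iso_inv f) = idm (F Y).
Proof. by rewrite -fmapM iso_vK fmap1. Qed.

Definition fmap_iso : iso (F X) (F Y) := Iso fmap_hK fmap_vK.

End MapIso.

Definition natural C D (F G : functor C D) (eta : forall X, hom (F X) (G X)) :=
  forall X Y (f : hom X Y), eta Y \oc fmap F f = fmap G f \oc eta X.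

Definition natiso C D (F G : functor C D) (eta : forall X, hom (F X) (G X)) :=
  natural eta /\ forall X, invertible (eta X).

Definition autoequivalence C (F : functor C C) :=
  exists (G : functor C C)
    (u : forall X, hom (fcomp G F X) (fid C X))
    (v : forall X, hom (fcomp F G X) (fid C X)),
    natiso u /\ natiso v.

(* Functors are compared by strict (Leibniz) equality.  The identity of X,   *)
(* seen as a morphism X -> Y along an equality X = Y, plays the role of the  *)
(* silent identification of equal objects; it does not depend on the proof   *)
(* of the equality.                                                          *)
Definition eqhom C (X Y : C) (e : X = Y) : hom X Y :=
  match e in _ = Y return hom X Y with erefl => idm X end.

Lemma feq_ob C D (F G : functor C D) : F = G -> forall X, F X = G X.
Proof. by move=> ->. Qed.

(* The trivial commutation, or more generally the identity natural
   transformation between equal functors. *)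
Definition eqnat C D (F G : functor C D) (e : F = G) (X : C) :
  hom (F X) (G X) := eqhom (feq_ob e X).

Lemma eqhom_id C (X : C) (e : X = X) : eqhom e = idm X.
Proof. by rewrite (Prop_irrelevance e erefl). Qed.

Lemma eqhomM C (X Y Z : C) (e1 : Y = Z) (e2 : X = Y) :
  eqhom e1 \oc eqhom e2 = eqhom (etrans e2 e1).
Proof. by case: _ / e1; rewrite /= comp1m; case: _ / e2. Qed.

Lemma fmap_eqhom C D (F : functor C D) (X Y : C) (e : X = Y) :
  fmap F (eqhom e) = eqhom (congr1 F e).
Proof. by case: _ / e; rewrite fmap1. Qed.

Lemma eqnat_nat C D (F G : functor C D) (e : F = G) : natural (eqnat e).
Proof.
by move=> X Y f; rewrite /eqnat; case: _ / e => /=; rewrite !eqhom_id comp1m compm1.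
Qed.

Lemma eqhom_nat C D (F G : functor C D) X Y (f : hom X Y) (e : F = G)
    (eX : F X = G X) (eY : F Y = G Y) :
  eqhom eY \oc fmap F f = fmap G f \oc eqhom eX.
Proof.
by rewrite (Prop_irrelevance eX (feq_ob e X)) (Prop_irrelevance eY (feq_ob e Y))
           -/(eqnat e X) -/(eqnat e Y) eqnat_nat.
Qed.

Lemma fcompA C (F G H : functor C C) :
  fcomp F (fcomp G H) = fcomp (fcomp F G) H.
Proof. by congr Functor; exact: Prop_irrelevance. Qed.

Lemma fcomp1f C (F : functor C C) : fcomp (fid C) F = F.
Proof. by case: F => *; congr Functor; exact: Prop_irrelevance. Qed.

Lemma fcompf1 C (F : functor C C) : fcomp F (fid C) = F.
Proof. by case: F => *; congr Functor; exact: Prop_irrelevance. Qed.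

Record autom C := Autom {
  afun :> functor C C;
  ainv : functor C C;
  afunK : fcomp ainv afun = fid C;
  ainvK : fcomp afun ainv = fid C
}.

Definition apow C (S : autom C) (i : int) : functor C C :=
  match i with
  | Posz n => iter n (fcomp S) (fid C)
  | Negz n => iter n.+1 (fcomp (ainv S)) (fid C)
  end.

Lemma apowS C (S : autom C) i : fcomp S (apow S i) = apow S (1 + i).
Proof.
case: i => [n|[|n]]; first by [].
  by rewrite /= fcompA ainvK fcomp1f.
have -> : 1 + Negz n.+1 = Negz n.
  by rewrite !NegzE [in - (n.+2)%:Z]intS opprD addrA subrr add0r.
by rewrite /= [LHS]fcompA ainvK fcomp1f.
Qed.

Lemma apowV C (S : autom C) i : fcomp (ainv S) (apow S i) = apow S (i - 1).
Proof. by rewrite -{1}[i](subrK 1) addrC -apowS fcompA afunK fcomp1f. Qed.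

Lemma apowD C (S : autom C) i j :
  fcomp (apow S i) (apow S j) = apow S (i + j).
Proof.
elim/int_rect: i => [|n IH|n IH].
- by rewrite fcomp1f add0r.
- by rewrite intS -apowS -fcompA IH apowS addrA.
- have -> : - n.+1%:Z = - n%:Z - 1 by rewrite intS opprD addrC.
  by rewrite -apowV -fcompA IH apowV addrAC.
Qed.

Lemma apow_commute C (S : autom C) (G : functor C C) i :
  fcomp G S = fcomp S G -> fcomp G (apow S i) = fcomp (apow S i) G.
Proof.
move=> GS; have GV : fcomp G (ainv S) = fcomp (ainv S) G.
  by rewrite -[LHS]fcomp1f -(afunK S) -fcompA (fcompA S) -GS -fcompA ainvK fcompf1.
elim/int_rect: i => [|n IH|n IH].
- by rewrite fcomp1f fcompf1.
- by rewrite intS -apowS fcompA GS -!fcompA IH.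
- have -> : - n.+1%:Z = - n%:Z - 1 by rewrite intS opprD addrC.
  by rewrite -apowV fcompA GV -!fcompA IH.
Qed.

End Basics.

Arguments fmap {k C D} F {X Y} f : rename.
Arguments fid {k} C.

Record triangulated (k : fieldType) := Triangulated {
  tcat :> lincat k;
  tcat_additive : additive_cat tcat;
  shift : autom tcat;
  dist : forall X Y Z : tcat, hom X Y -> hom Y Z -> hom Z (shift X) -> Prop;
  dist_iso : forall (X Y Z X' Y' Z' : tcat)
    (f : hom X Y) (g : hom Y Z) (h : hom Z (shift X))
    (f' : hom X' Y') (g' : hom Y' Z') (h' : hom Z' (shift X'))
    (a : iso X X') (b : iso Y Y') (c : iso Z Z'),
    b \oc f = f' \oc a -> c \oc g = g' \oc b -> fmap shift a \oc h = h' \oc c ->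
    dist f g h -> dist f' g' h';
  dist_id : forall X Z : tcat, is_zero_ob Z ->
    dist (idm X) (0 : hom X Z) (0 : hom Z (shift X));
  dist_ex : forall (X Y : tcat) (f : hom X Y),
    exists (Z : tcat) (g : hom Y Z) (h : hom Z (shift X)), dist f g h;
  dist_rot : forall (X Y Z : tcat)
    (f : hom X Y) (g : hom Y Z) (h : hom Z (shift X)),
    dist f g h <-> dist g h (- fmap shift f);
  dist_mor : forall (X Y Z X' Y' Z' : tcat)
    (f : hom X Y) (g : hom Y Z) (h : hom Z (shift X))
    (f' : hom X' Y') (g' : hom Y' Z') (h' : hom Z' (shift X'))
    (a : hom X X') (b : hom Y Y'),
    dist f g h -> dist f' g' h' -> b \oc f = f' \oc a ->
    exists c : hom Z Z', c \oc g = g' \oc b /\ fmap shift a \oc h = h' \oc c;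
  dist_oct : forall (X Y Z X' Y' Z' : tcat)
    (f : hom X Y) (u : hom Y Z') (u' : hom Z' (shift X))
    (g : hom Y Z) (v : hom Z X') (v' : hom X' (shift Y))
    (w : hom Z Y') (w' : hom Y' (shift X)),
    dist f u u' -> dist g v v' -> dist (g \oc f) w w' ->
    exists (a : hom Z' Y') (b : hom Y' X'),
      [/\ dist a b (fmap shift u \oc v'), a \oc u = w \oc g, w' \oc a = u',
          b \oc w = v & v' \oc b = fmap shift f \oc w']
}.

Arguments shift {k} t.

Definition exact (k : fieldType) (C : triangulated k) (U : functor C C)
    (eta : forall X, hom (fcomp U (shift C) X) (fcomp (shift C) U X)) :=
  natiso eta /\
  forall (X Y Z : C) (f : hom X Y) (g : hom Y Z) (h : hom Z (shift C X)),
    dist f g h -> dist (fmap U f) (fmap U g) (eta X \oc fmap U h).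

Record gtriangulated (k : fieldType) := GTriangulated {
  gcat :> triangulated k;
  tw : autom gcat;
  tw_shift : fcomp tw (shift gcat) = fcomp (shift gcat) tw;
  tw_exact : exact (eqnat tw_shift)
}.

Arguments tw {k} g.

Record serre (k : fieldType) (C : lincat k) := Serre {
  sfun :> functor C C;
  sfun_equiv : autoequivalence sfun;
  alpha : forall X Y : C, {linear hom X Y -> 'Hom(hom Y (sfun X), k^o)};
  alpha_bij : forall X Y : C, bijective (@alpha X Y);
  alpha_natl : forall (X X' Y : C) (u : hom X' X) (f : hom X Y)
    (h : hom Y (sfun X')),
    alpha X' Y (f \oc u) h = alpha X Y f (fmap sfun u \oc h);
  alpha_natr : forall (X Y Y' : C) (v : hom Y Y') (f : hom X Y)
    (h : hom Y' (sfun X)),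
    alpha X Y' (v \oc f) h = alpha X Y f (h \oc v)
}.

Definition Tr (k : fieldType) (C : lincat k) (F : serre C) (X : C)
  (f : hom X (F X)) : k := alpha F X X (idm X) f.

Arguments Tr {k C} F X f.

(* eta is the commutation eta_eps(S), i.e. Tr_X (S^-1 (eta_X o f)) is        *)
(* eps * Tr_(SX) f; the eqnat's identify S^-1 S with the identity functor.   *)
Definition is_eta (k : fieldType) (C : lincat k) (F : serre C) (S : autom C)
    (eps : k) (eta : forall X, hom (fcomp F S X) (fcomp S F X)) :=
  natiso eta /\
  forall (X : C) (f : hom (S X) (F (S X))),
    Tr F X (eqnat (afunK S) (F X) \oc fmap (ainv S) (eta X \oc f)
              \oc eqnat (esym (afunK S)) X)
    = eps * Tr F (S X) f.

Section Graded.
Variables (k : fieldType) (C : gtriangulated k).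
Local Notation Sg := (shift C).
Local Notation T := (tw C).
Implicit Types (X Y Z W : C) (m n p : int * int).

Definition sh n : functor C C := fcomp (apow Sg n.1) (apow T n.2).

Lemma sh_commute (G : functor C C) n :
  fcomp G Sg = fcomp Sg G -> fcomp G T = fcomp T G ->
  fcomp G (sh n) = fcomp (sh n) G.
Proof.
move=> GS GT; rewrite /sh fcompA (apow_commute _ GS) -!fcompA.
by rewrite (apow_commute _ GT).
Qed.

Lemma shD m n : fcomp (sh m) (sh n) = sh (m + n).
Proof.
have comm i j : fcomp (apow T j) (apow Sg i) = fcomp (apow Sg i) (apow T j).
  apply: apow_commute; apply: esym; apply: apow_commute.
  by rewrite tw_shift.
rewrite /sh -fcompA [in X in fcomp _ X]fcompA comm -fcompA fcompA.
by rewrite !apowD.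
Qed.

Definition ghom n X Y : vectType k := hom X (sh n Y).

(* [sh 0 Y] reduces to [Y]. *)
Definition deg0 X Y (f : hom X Y) : ghom 0 X Y := f.

Definition gcomp m n X Y Z (g : ghom n Y Z) (f : ghom m X Y) :
  ghom (m + n) X Z := eqnat (shD m n) Z \oc (fmap (sh m) g \oc f).

Definition gcast m n X Y (e : m = n) (f : ghom m X Y) : ghom n X Y :=
  eqhom (congr1 (fun p => sh p Y) e) \oc f.

End Graded.

Arguments shD {k C} m n : rename.

Notation "g \*g f" := (gcomp g f) (at level 40, left associativity).

Record dirsum (k : fieldType) (I : choiceType) (V : I -> lmodType k) := DirSum {
  dcoef :> forall i, V i;
  dcoef_fin : finite_set [set i | dcoef i != 0]
}.

Section DirSum.
Variables (k : fieldType) (I : choiceType) (V : I -> lmodType k).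
Local Notation A := (dirsum V).
Implicit Types x y z : A.

Lemma dirsumP x y : (forall i, x i = y i) -> x = y.
Proof.
case: x y => [x Px] [y Py] /= xy; have {}xy : x = y by apply: functional_extensionality_dep.
by case: _ / xy Py => Py; rewrite (Prop_irrelevance Px Py).
Qed.

HB.instance Definition _ := gen_eqMixin A.
HB.instance Definition _ := gen_choiceMixin A.

Lemma ds0_fin : finite_set [set i | (0 : V i) != 0].
Proof. by rewrite (_ : mkset _ = set0) //; apply/seteqP; split=> i //=; rewrite eqxx. Qed.
Definition ds0 : A := DirSum ds0_fin.

Lemma dsN_fin x : finite_set [set i | - x i != 0].
Proof. by apply: sub_finite_set (dcoef_fin x) => i /=; rewrite oppr_eq0. Qed.
Definition dsN x : A := DirSum (dsN_fin x).

Lemma dsD_fin x y : finite_set [set i | x i + y i != 0].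
Proof.
have: finite_set ([set i | x i != 0] `|` [set i | y i != 0]).
  by rewrite finite_setU; split; exact: dcoef_fin.
apply: sub_finite_set => i /=; case: (eqVneq (x i) 0) => [->|]; last by left.
by rewrite add0r; right.
Qed.
Definition dsD x y : A := DirSum (dsD_fin x y).

Lemma dsZ_fin (a : k) x : finite_set [set i | a *: x i != 0].
Proof.
apply: sub_finite_set (dcoef_fin x) => i /=.
by apply: contra_neq => ->; rewrite scaler0.
Qed.
Definition dsZ a x : A := DirSum (dsZ_fin a x).

Let dsDA : associative dsD.
Proof. by move=> x y z; apply: dirsumP => i /=; rewrite addrA. Qed.
Let dsDC : commutative dsD.
Proof. by move=> x y; apply: dirsumP => i /=; rewrite addrC. Qed.
Let ds0D : left_id ds0 dsD.
Proof. by move=> x; apply: dirsumP => i /=; rewrite add0r. Qed.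
Let dsND : left_inverse ds0 dsN dsD.
Proof. by move=> x; apply: dirsumP => i /=; rewrite addNr. Qed.

HB.instance Definition _ := GRing.isZmodule.Build A dsDA dsDC ds0D dsND.

Let dsZA a b x : dsZ a (dsZ b x) = dsZ (a * b) x.
Proof. by apply: dirsumP => i /=; rewrite scalerA. Qed.
Let ds1Z : left_id 1 dsZ.
Proof. by move=> x; apply: dirsumP => i /=; rewrite scale1r. Qed.
Let dsZDr : right_distributive dsZ +%R.
Proof. by move=> a x y; apply: dirsumP => i /=; rewrite scalerDr. Qed.
Let dsZDl x : {morph dsZ^~ x : a b / a + b}.
Proof. by move=> a b; apply: dirsumP => i /=; rewrite scalerDl. Qed.

HB.instance Definition _ :=
  GRing.Zmodule_isLmodule.Build k A dsZA ds1Z dsZDr dsZDl.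

Lemma dcoefD x y i : (x + y) i = x i + y i. Proof. by []. Qed.
Lemma dcoefZ a x i : (a *: x) i = a *: x i. Proof. by []. Qed.
Lemma dcoef0 i : (0 : A) i = 0. Proof. by []. Qed.

Definition dinj_fun i (v : V i) j : V j :=
  match i =P j with
  | ReflectT e => ecast j (V j) e v
  | ReflectF _ => 0
  end.

Lemma dinj_fun_fin i (v : V i) : finite_set [set j | dinj_fun v j != 0].
Proof.
apply: sub_finite_set (finite_set1 i) => j /=; rewrite /dinj_fun.
by case: eqP => [e _|]; rewrite ?eqxx.
Qed.

Definition dinj i (v : V i) : A := DirSum (dinj_fun_fin v).

Lemma dinj_diag i (v : V i) : dinj v i = v.
Proof.
by rewrite /= /dinj_fun; case: eqP => // e; rewrite (Prop_irrelevance e erefl).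
Qed.

Lemma dinj_off i j (v : V i) : i != j -> dinj v j = 0.
Proof. by rewrite /= /dinj_fun; case: eqP. Qed.

Lemma dinj_linear i : linear (@dinj i).
Proof.
move=> a u v; apply: dirsumP => j; rewrite dcoefD dcoefZ.
case: (eqVneq i j) => [<-|ij]; first by rewrite !dinj_diag.
by rewrite !dinj_off // scaler0 addr0.
Qed.

HB.instance Definition _ i :=
  GRing.isLinear.Build k (V i) A *:%R (@dinj i) (@dinj_linear i).

Lemma dcoef_sum (J : Type) (r : seq J) (F : J -> A) i :
  (\sum_(j <- r) F j) i = \sum_(j <- r) F j i.
Proof. by elim/big_rec2: _ => //= j u v _ <-. Qed.

Lemma dirsum_suppP x :
  exists2 s : seq I, uniq s & forall i, i \notin s -> x i = 0.
Proof.
have /finite_seqP[s es] := dcoef_fin x; exists (undup s); first exact: undup_uniq.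
move=> i; rewrite mem_undup => /negP si; apply/eqP; apply/negPn/negP => xi.
by apply: si; have : [set i | x i != 0] i by []; rewrite es.
Qed.

Lemma dirsumE x (s : seq I) : uniq s -> (forall i, i \notin s -> x i = 0) ->
  x = \sum_(i <- s) dinj (x i).
Proof.
move=> us xs; apply: dirsumP => i; rewrite dcoef_sum.
case: (boolP (i \in s)) => [si|si].
  rewrite (bigD1_seq i si us) dinj_diag big1 => [|j ji].
    by rewrite [RHS]addr0.
  by rewrite dinj_off.
rewrite xs // big1_seq // => j /andP[_ sj]; rewrite dinj_off //.
by apply: contraNneq si => <-.
Qed.

Lemma dirsum_ind (P : A -> Prop) :
  P 0 -> (forall x y, P x -> P y -> P (x + y)) ->
  (forall i (v : V i), P (dinj v)) -> forall x, P x.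
Proof.
move=> P0 PD Pi x; have [s us xs] := dirsum_suppP x.
by rewrite (dirsumE us xs); elim/big_ind: _.
Qed.

End DirSum.

(* Associative unital k-algebras.  MathComp's algebra structures all exclude *)
(* the zero ring, but E(X) is zero when X is a zero object.                  *)
Record kalg (k : fieldType) := KAlg {
  kmod :> lmodType k;
  kmul : kmod -> kmod -> kmod;
  kone : kmod;
  kmul_linl : forall y, linear (kmul^~ y);
  kmul_linr : forall x, linear (kmul x);
  kmulA : associative kmul;
  kmul1x : left_id kone kmul;
  kmulx1 : right_id kone kmul
}.

Arguments kone {k} A : rename.

Notation "x \*a y" := (kmul x y) (at level 40, left associativity).

Section EndAlg.
Variables (k : fieldType) (C : gtriangulated k).
Implicit Types (X Y Z W : C) (m n p : int * int).

Lemma gcomp_linl m n X Y Z (f : ghom m X Y) :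
  linear (fun g : ghom n Y Z => g \*g f).
Proof. by move=> a u v; rewrite /gcomp fmap_lin comp_linl comp_linr. Qed.

Lemma gcomp_linr m n X Y Z (g : ghom n Y Z) :
  linear (fun f : ghom m X Y => g \*g f).
Proof. by move=> a u v; rewrite /gcomp !comp_linr. Qed.

Lemma gcomp_linl0 m n X Y Z (f : ghom m X Y) : (0 : ghom n Y Z) \*g f = 0.
Proof. by have := gcomp_linl f (-1) 0 (0 : ghom n Y Z); rewrite scaler0 addr0 scaleN1r addNr. Qed.

Lemma gcomp_linr0 m n X Y Z (g : ghom n Y Z) : g \*g (0 : ghom m X Y) = 0.
Proof. by have := gcomp_linr g (-1) 0 (0 : ghom m X Y); rewrite scaler0 addr0 scaleN1r addNr. Qed.

Lemma gcompA m n p X Y Z W (h : ghom p Z W) (g : ghom n Y Z) (f : ghom m X Y) :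
  gcast (addrA m n p) ((h \*g g) \*g f) = h \*g (g \*g f).
Proof.
have nat := eqnat_nat (shD m n) h; rewrite /gcast /gcomp !fmapM.
rewrite !compA -[in RHS](compA _ (fmap _ h)) -nat !compA.
rewrite /eqnat fmap_eqhom !eqhomM.
by congr (eqhom _ \oc _ \oc _ \oc _); exact: Prop_irrelevance.
Qed.

Lemma gcomp1x n X Y (f : ghom n X Y) : gcast (addr0 n) (deg0 (idm Y) \*g f) = f.
Proof.
rewrite /gcast /gcomp /deg0 [fmap _ _](fmap1 (sh C n)) compA eqhomM compA.
by rewrite eqhom_id !comp1m.
Qed.

Lemma gcompx1 n X Y (f : ghom n X Y) : gcast (add0r n) (f \*g deg0 (idm X)) = f.
Proof.
by rewrite /gcast /gcomp /deg0 [f in _ \oc (_ \oc f)]/= compm1 compA eqhomM eqhom_id comp1m.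
Qed.

Section Def.
Variable X : C.

Definition endmod : lmodType k := dirsum (fun n => ghom n X X : lmodType k).
Implicit Types x y z : endmod.

Definition hinj n (f : ghom n X X) : endmod :=
  @dinj k _ (fun n => ghom n X X : lmodType k) n f.

(* A finite sum: all but finitely many terms vanish. *)
Definition emul x y : endmod :=
  \sum_(p \in [set: (int * int) * (int * int)]) hinj (x p.1 \*g y p.2).

Definition eone : endmod := hinj (deg0 (idm X)).

Lemma hinj_lin n : linear (@hinj n). Proof. exact: dinj_linear. Qed.

Lemma hinj0 n : hinj (0 : ghom n X X) = 0.
Proof. by have := hinj_lin (-1) 0 (0 : ghom n X X); rewrite scaler0 addr0 scaleN1r addNr. Qed.

Lemma hinj_gcast m n (e : m = n) (f : ghom m X X) : hinj (gcast e f) = hinj f.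
Proof. by case: _ / e; rewrite /gcast /= comp1m. Qed.

Lemma emulE x y (s1 s2 : seq (int * int)) : uniq s1 -> uniq s2 ->
  (forall n, n \notin s1 -> x n = 0) -> (forall n, n \notin s2 -> y n = 0) ->
  emul x y = \sum_(m <- s1) \sum_(n <- s2) hinj (x m \*g y n).
Proof.
move=> u1 u2 x0 y0; rewrite /emul.
rewrite (fsbigE [seq (m, n) | m <- s1, n <- s2]) //=.
- by under eq_bigl do rewrite in_setT; rewrite big_allpairs.
- by apply: allpairs_uniq => // -[a b] [c e].
- move=> [m n] _ mn; have [m1|m1] := boolP (m \in s1); last first.
    by rewrite x0 // gcomp_linl0 hinj0.
  have [n2|n2] := boolP (n \in s2); last by rewrite y0 // gcomp_linr0 hinj0.
  by case/negP: mn; apply/allpairsP; exists (m, n).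
Qed.

Lemma supp2P x y : exists2 s : seq (int * int), uniq s &
  (forall n, n \notin s -> x n = 0) /\ (forall n, n \notin s -> y n = 0).
Proof.
have [s1 _ x0] := dirsum_suppP x; have [s2 _ y0] := dirsum_suppP y.
exists (undup (s1 ++ s2)); first exact: undup_uniq.
by split=> n; rewrite mem_undup mem_cat negb_or => /andP[n1 n2]; [exact: x0|exact: y0].
Qed.

Lemma emul_linl y : linear (emul^~ y).
Proof.
move=> a x x'; have [s us [x0 x'0]] := supp2P x x'.
have [r ur y0] := dirsum_suppP y.
have xx0 n : n \notin s -> (a *: x + x') n = 0.
  by move=> ns; rewrite dcoefD dcoefZ x0 // x'0 // scaler0 addr0.
rewrite (emulE us ur xx0 y0) (emulE us ur x0 y0) (emulE us ur x'0 y0).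
rewrite scaler_sumr -big_split; apply: eq_bigr => m _.
rewrite [RHS]/= scaler_sumr -big_split; apply: eq_bigr => n _.
by rewrite dcoefD dcoefZ gcomp_linl hinj_lin.
Qed.

Lemma emul_linr x : linear (emul x).
Proof.
move=> a y y'; have [s us [y0 y'0]] := supp2P y y'.
have [r ur x0] := dirsum_suppP x.
have yy0 n : n \notin s -> (a *: y + y') n = 0.
  by move=> ns; rewrite dcoefD dcoefZ y0 // y'0 // scaler0 addr0.
rewrite (emulE ur us x0 yy0) (emulE ur us x0 y0) (emulE ur us x0 y'0).
rewrite scaler_sumr -big_split; apply: eq_bigr => m _.
rewrite [RHS]/= scaler_sumr -big_split; apply: eq_bigr => n _.
by rewrite dcoefD dcoefZ gcomp_linr hinj_lin.
Qed.

Lemma emulDl x x' y : emul (x + x') y = emul x y + emul x' y.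
Proof. by have := emul_linl y 1 x x'; rewrite !scale1r. Qed.

Lemma emulDr x y y' : emul x (y + y') = emul x y + emul x y'.
Proof. by have := emul_linr x 1 y y'; rewrite !scale1r. Qed.

Lemma emul0x y : emul 0 y = 0.
Proof. by apply: (addrI (emul 0 y)); rewrite -emulDl !addr0. Qed.

Lemma emulx0 x : emul x 0 = 0.
Proof. by apply: (addrI (emul x 0)); rewrite -emulDr !addr0. Qed.

Lemma emul_hinj m n (g : ghom n X X) (f : ghom m X X) :
  emul (hinj g) (hinj f) = hinj (g \*g f).
Proof.
rewrite (@emulE _ _ [:: n] [:: m]) //; first last.
- by move=> p; rewrite inE eq_sym => mp; rewrite dinj_off.
- by move=> p; rewrite inE eq_sym => mp; rewrite dinj_off.
by rewrite !big_seq1 !dinj_diag.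
Qed.

Lemma emulA : associative emul.
Proof.
move=> x y z; elim/dirsum_ind: x => [|x x' IH IH'|p h].
- by rewrite !emul0x.
- by rewrite !emulDl IH IH'.
elim/dirsum_ind: y => [|y y' IH IH'|n g].
- by rewrite !(emul0x, emulx0).
- by rewrite !(emulDl, emulDr) IH IH'.
elim/dirsum_ind: z => [|z z' IH IH'|m f].
- by rewrite !emulx0.
- by rewrite !emulDr IH IH'.
rewrite -/(hinj h) -/(hinj g) -/(hinj f) !emul_hinj.
by rewrite -(gcompA h g f) hinj_gcast.
Qed.

Lemma emul1x : left_id eone emul.
Proof.
elim/dirsum_ind => [|x y IHx IHy|n f]; first exact: emulx0.
  by rewrite emulDr IHx IHy.
by rewrite -/(hinj f) emul_hinj -[in RHS](gcomp1x f) hinj_gcast.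
Qed.

Lemma emulx1 : right_id eone emul.
Proof.
elim/dirsum_ind => [|x y IHx IHy|n f]; first exact: emul0x.
  by rewrite emulDl IHx IHy.
by rewrite -/(hinj f) emul_hinj -[in RHS](gcompx1 f) hinj_gcast.
Qed.

Definition endalg : kalg k :=
  KAlg emul_linl emul_linr emulA emul1x emulx1.

End Def.
End EndAlg.

Section Frobenius.
Variables (k : fieldType) (A : kalg k).

Record bigrading (D : int * int -> set A) : Prop := Bigrading {
  bigr_lin : forall n (a : k) (x y : A), D n x -> D n y -> D n (a *: x + y);
  bigr_0 : forall n, D n 0;
  bigr_span : forall x : A, exists (s : seq (int * int)) (c : int * int -> A),
    (forall n, D n (c n)) /\ x = \sum_(n <- s) c n;
  bigr_free : forall (s : seq (int * int)) (c : int * int -> A), uniq s ->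
    (forall n, D n (c n)) -> \sum_(n <- s) c n = 0 ->
    forall n, n \in s -> c n = 0;
  bigr_one : D 0 (kone A);
  bigr_mul : forall m n (x y : A), D m x -> D n y -> D (m + n) (x \*a y)
}.

Record frobenius (B : {biscalar A}) (mu : A -> A) : Prop := Frobenius {
  frob_assoc : forall x y z : A, B (x \*a y) z = B x (y \*a z);
  frob_nondegl : forall x : A, (forall y, B x y = 0) -> x = 0;
  frob_nondegr : forall y : A, (forall x, B x y = 0) -> y = 0;
  frob_aut_lin : linear mu;
  frob_aut_one : mu (kone A) = kone A;
  frob_aut_mul : {morph mu : x y / x \*a y};
  frob_aut_bij : bijective mu;
  frob_nakayama : forall x y : A, B x y = B (mu y) x
}.

End Frobenius.

Section Standing.
Variables (k : fieldType) (C : gtriangulated k).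
Local Notation Sg := (shift C).
Local Notation T := (tw C).

Lemma serre_shift (F Phi : functor C C) n :
  F = fcomp (sh C n) Phi -> fcomp Phi Sg = fcomp Sg Phi ->
  fcomp F Sg = fcomp Sg F.
Proof.
move=> -> PS; rewrite -fcompA PS (fcompA (sh C n)) (fcompA Sg (sh C n)).
by rewrite (@sh_commute _ _ Sg) // tw_shift.
Qed.

Lemma serre_tw (F Phi : functor C C) n :
  F = fcomp (sh C n) Phi -> fcomp Phi T = fcomp T Phi ->
  fcomp F T = fcomp T F.
Proof.
move=> -> PT; rewrite -fcompA PT (fcompA (sh C n)) (fcompA T (sh C n)).
by rewrite (@sh_commute _ _ T) // tw_shift.
Qed.

(* The Serre isomorphisms alpha come with F; T, its commutation with Sigma   *)
(* and its exactness come with C.  The fields st_etaE and st_thetaE say that *)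
(* eta = s . 1 and theta = t . 1.                                            *)
Record standing (F : serre C) (Phi : functor C C) (d l : int) (s t : k) :=
  Standing {
  st_equiv : autoequivalence Phi;
  st_shift : fcomp Phi Sg = fcomp Sg Phi;
  st_tw : fcomp Phi T = fcomp T Phi;
  st_exact : exact (eqnat st_shift);
  st_serre : F = fcomp (sh C (d, l)) Phi :> functor C C;
  st_eta : forall X, hom (fcomp F Sg X) (fcomp Sg F X);
  st_etaP : is_eta (-1) st_eta;
  st_theta : forall X, hom (fcomp F T X) (fcomp T F X);
  st_thetaP : is_eta 1 st_theta;
  st_s : s != 0;
  st_t : t != 0;
  st_etaE : forall X, st_eta X = s *: eqnat (serre_shift st_serre st_shift) X;
  st_thetaE : forall X, st_theta X = t *: eqnat (serre_tw st_serre st_tw) X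
}.

(* Phi f, with target Phi (Sigma^i T^j Y) identified with Sigma^i T^j (Phi Y) *)
Definition gfmap F Phi d l s t (H : @standing F Phi d l s t) n (X Y : C)
    (f : ghom n X Y) : ghom n (Phi X) (Phi Y) :=
  eqnat (sh_commute n (st_shift H) (st_tw H)) Y \oc fmap Phi f.

Lemma deg_compl (i j d l : int) : (i, j) + (d - i, l - j) = (d, l).
Proof. by congr pair; rewrite addrC subrK. Qed.

Lemma deg_compl0 (i j d l : int) : (i, j) + (d - i, l - j) + 0 = (d, l).
Proof. by rewrite addr0 deg_compl. Qed.

Lemma deg_conj (n : int * int) : 0 + n + 0 = n.
Proof. by rewrite addr0 add0r. Qed.

Lemma sh_compl (i j d l : int) :
  fcomp (sh C (i, j)) (sh C (d - i, l - j)) = sh C (d, l).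
Proof. by rewrite shD deg_compl. Qed.

End Standing.

(* Main.v *)
Require Import Defs.

Set Warnings "-notation-overridden,-ambiguous-paths,-notation-incompatible-prefix,-redundant-canonical-projection".

From HB Require Import structures.
From mathcomp Require Import all_boot all_order all_algebra.
From mathcomp Require Import boolp classical_sets functions cardinality fsbigop.
From mathcomp Require Import sesquilinear.

Set Implicit Arguments.
Unset Strict Implicit.
Unset Printing Implicit Defensive.

Import GRing.Theory.

Local Open Scope classical_set_scope.
Local Open Scope ring_scope.

(** Write [Sigma^m] for [Sigma^i T^j] when [m = (i, j)].  The form is
    [(x, y) = tau ((x * y)_(d,l))], where [tau h = Tr_X (Sigma^d T^l (phi) o h)]
    on the component of degree [(d, l)], so associativity is that
    of the graded composition.

    Nondegeneracy in the second variable is Serre duality.  For [g] of degree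
    [m], the pairings of [g] with homogeneous elements are the scalars
    [Tr (h o g) = alpha g h] with [h : Sigma^m X -> F X]; every [h] occurs,
    since [Sigma^m] is full and [phi] is invertible ([frob_dual_surj]), and
    [alpha] is injective.

    For the Nakayama identity, naturality of [alpha] gives
    [Tr_X (h o g) = Tr_(Sigma^m X) (F g o h)] ([Tr_comp]).  The composite
    [F g o h] is the translate by [Sigma^m] of [Phi(g) * phi * f], up to the
    silent identifications.  By hypothesis [Sigma] multiplies traces by [- s]
    and [T] by [t] ([scales_trace_eta]); this property is stable under
    composition and inverses, so [Sigma^i T^j] multiplies traces by
    [(-s)^i t^j] ([scales_trace_sh]), which is the scalar in the Nakayama
    automorphism ([ctrace_nak]).

    The rest is formal.  By nondegeneracy the map
    [mu g = (-s)^i t^j phi^-1 * Phi(g) * phi] is injective in each degree,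
    hence bijective because Hom spaces are finite-dimensional.  Nondegeneracy in the first variable and multiplicativity of [mu] then
    follow from [(x, y) = (mu y, x)] ([frobenius_of_nakayama]).

    Identifications of equal objects are handled by comparing morphisms bundled
    with their endpoints ([arr]), for which every [eqhom] can be erased. *)

(* Morphism spaces and associativity of a linear category, which [vector.hom]
   and [ssrfun.compA] would otherwise hide. *)
Local Notation hom := Defs.hom.
Local Notation compA := Defs.compA.

(** * Erasing identifications of equal objects *)

Section Arrows.
Variable k : fieldType.
Implicit Types C D : lincat k.

(** A morphism bundled with its source and target.  Equality of bundled
    morphisms is equality up to the identifications [eqhom] of equal objects;
    it is the relation in which silently commuted functors are computed with. *)
Definition arr C (X Y : C) (f : hom X Y) : {p : C * C & hom p.1 p.2} :=
  existT (fun p : C * C => hom p.1 p.2) (X, Y) f.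

Lemma arrP C (X Y X' Y' : C) (f : hom X Y) (f' : hom X' Y') :
  arr f = arr f' ->
  exists (eX : X = X') (eY : Y = Y'), eqhom eY \oc f = f' \oc eqhom eX.
Proof.
move=> e.
pose P (q : {p : C * C & hom p.1 p.2}) :=
  exists (eX : X = (projT1 q).1) (eY : Y = (projT1 q).2),
    eqhom eY \oc f = projT2 q \oc eqhom eX.
suff : P (arr f') by [].
by rewrite -e; exists erefl, erefl; rewrite /= comp1m compm1.
Qed.

Lemma arr_inj C (X Y : C) (f g : hom X Y) : arr f = arr g -> f = g.
Proof. by case/arrP=> eX [eY]; rewrite !eqhom_id comp1m compm1. Qed.

Lemma arr_eqhoml C (X Y Z : C) (e : Y = Z) (f : hom X Y) :
  arr (eqhom e \oc f) = arr f.
Proof. by case: _ / e; rewrite comp1m. Qed.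

Lemma arr_eqhomr C (X Y Z : C) (e : X = Y) (f : hom Y Z) :
  arr (f \oc eqhom e) = arr f.
Proof. by case: _ / e f => f; rewrite compm1. Qed.

Lemma arr_eqnatl C D (F G : functor C D) (e : F = G) X Y (f : hom Y (F X)) :
  arr (eqnat e X \oc f) = arr f.
Proof. exact: arr_eqhoml. Qed.

Lemma arr_comp C (X Y Z X' Y' Z' : C) (f : hom X Y) (g : hom Y Z)
    (f' : hom X' Y') (g' : hom Y' Z') :
  arr f = arr f' -> arr g = arr g' -> arr (g \oc f) = arr (g' \oc f').
Proof.
move=> /arrP[eX [eY ef]] /arrP[eY' [eZ eg]].
rewrite -(arr_eqhoml eZ) -(arr_eqhomr eX (g' \oc f')) compA eg -!compA -ef.
by rewrite (Prop_irrelevance eY eY').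
Qed.

Lemma arr_fmap C D (G : functor C D) (X Y X' Y' : C)
    (f : hom X Y) (f' : hom X' Y') :
  arr f = arr f' -> arr (fmap G f) = arr (fmap G f').
Proof.
move=> /arrP[eX [eY ef]].
by rewrite -(arr_eqhoml (congr1 G eY)) -(arr_eqhomr (congr1 G eX) (fmap G f'))
           -!fmap_eqhom -!fmapM ef.
Qed.

Lemma arr_functor C D (F G : functor C D) (X Y : C) (f : hom X Y) :
  F = G -> arr (fmap F f) = arr (fmap G f).
Proof. by move=> ->. Qed.

Lemma arr_Tr C (F : serre C) (X X' : C) (f : hom X (F X)) (f' : hom X' (F X')) :
  arr f = arr f' -> Tr F X f = Tr F X' f'.
Proof.
case/arrP=> eX [eY]; case: _ / eX f' eY => f' eY.
by rewrite eqhom_id comp1m compm1 => ->.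
Qed.

Lemma compZl C (X Y Z : C) (a : k) (g : hom Y Z) (f : hom X Y) :
  (a *: g) \oc f = a *: (g \oc f).
Proof. exact: (scalable_linear (comp_linl f)). Qed.

Lemma compZr C (X Y Z : C) (a : k) (g : hom Y Z) (f : hom X Y) :
  g \oc (a *: f) = a *: (g \oc f).
Proof. exact: (scalable_linear (comp_linr g)). Qed.

End Arrows.

Section GradedArrows.
Variables (k : fieldType) (C : gtriangulated k).
Implicit Types (X Y Z : C) (m n : int * int).

Lemma arr_gcast m n X Y (e : m = n) (f : ghom m X Y) :
  arr (gcast e f : hom X (sh C n Y)) = arr (f : hom X (sh C m Y)).
Proof. exact: arr_eqhoml. Qed.

Lemma arr_gcomp m n X Y Z (g : ghom n Y Z) (f : ghom m X Y) :
  arr (g \*g f : hom X (sh C (m + n) Z))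
    = arr (fmap (sh C m) g \oc f : hom X (sh C m (sh C n Z))).
Proof. exact: arr_eqhoml. Qed.

Lemma arr_shD m n X Y (f : hom X Y) :
  arr (fmap (sh C m) (fmap (sh C n) f)) = arr (fmap (sh C (m + n)) f).
Proof. exact: (arr_functor f (shD m n)). Qed.

(** [sh m] is full, with partial inverse [sh (- m)]. *)
Lemma sh_full m X Y (h : hom (sh C m X) (sh C m Y)) :
  exists f : hom X Y, fmap (sh C m) f = h.
Proof.
have e Z : sh C (- m) (sh C m Z) = Z.
  by have := feq_ob (shD (- m) m) Z; rewrite addNr.
exists (eqhom (e Y) \oc fmap (sh C (- m)) h \oc eqhom (esym (e X))).
apply: arr_inj; have -> : arr h = arr (fmap (sh C m) (fmap (sh C (- m)) h)).
  by rewrite arr_shD addrN.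
by apply: arr_fmap; rewrite arr_eqhomr arr_eqhoml.
Qed.

End GradedArrows.

(** * Traces under powers of the translation functors *)

Section TraceScaling.
Variables (k : fieldType) (C : lincat k) (F : serre C).
Implicit Types (G : functor C C) (S : autom C) (c : k).

Lemma Tr_comp (X Y : C) (u : hom X Y) (h : hom Y (F X)) :
  Tr F X (h \oc u) = Tr F Y (fmap F u \oc h).
Proof. by rewrite /Tr -alpha_natr compm1 -alpha_natl comp1m. Qed.

Lemma TrZ (X : C) (a : k) (f : hom X (F X)) : Tr F X (a *: f) = a * Tr F X f.
Proof. by rewrite /Tr linearZ. Qed.

Lemma TrD (X : C) (f g : hom X (F X)) : Tr F X (f + g) = Tr F X f + Tr F X g.
Proof. by rewrite /Tr linearD. Qed.

(** [G] commutes with the Serre functor and multiplies traces by [c]. *)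
Definition scales_trace G c :=
  fcomp F G = fcomp G F /\
  forall (Y : C) (v : hom Y (F Y)) (w : hom (G Y) (F (G Y))),
    arr w = arr (fmap G v) -> Tr F (G Y) w = c * Tr F Y v.

Lemma scales_trace_id : scales_trace (fid C) 1.
Proof.
split=> [|Y v w]; first by rewrite fcomp1f fcompf1.
by move=> e; rewrite mul1r; apply: arr_Tr e.
Qed.

Lemma scales_trace_comp G G' c c' : scales_trace G c -> scales_trace G' c' ->
  scales_trace (fcomp G G') (c * c').
Proof.
move=> [FG GP] [FG' GP']; split=> [|Y v w e].
  by rewrite fcompA FG -fcompA FG' fcompA.
pose v' : hom (G' Y) (F (G' Y)) := eqnat (esym FG') Y \oc fmap G' v.
have ev' : arr v' = arr (fmap G' v) by exact: arr_eqhoml.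
rewrite -mulrA -(GP' _ v v' ev'); apply: GP.
exact: etrans e (arr_fmap G (esym ev')).
Qed.

Lemma scales_trace_inv S c : c != 0 -> scales_trace S c ->
  scales_trace (ainv S) c^-1.
Proof.
move=> c0 [FS SP]; have FV : fcomp F (ainv S) = fcomp (ainv S) F.
  by rewrite -[LHS]fcomp1f -(afunK S) -fcompA (fcompA S) -FS -fcompA ainvK fcompf1.
split=> // Y v w e; apply: (mulfI c0); rewrite mulrA divff // mul1r.
pose w' : hom (S (ainv S Y)) (F (S (ainv S Y))) :=
  eqnat (esym FS) (ainv S Y) \oc fmap S w.
have ew' : arr w' = arr (fmap S w) by exact: arr_eqhoml.
rewrite -(SP _ w w' ew'); apply: arr_Tr; rewrite ew' (arr_fmap S e).
exact: (arr_functor v (ainvK S)).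
Qed.

Lemma scales_trace_pow S c (i : int) : c != 0 -> scales_trace S c ->
  scales_trace (apow S i) (c ^ i).
Proof.
move=> c0 Sc; elim/int_rect: i => [|n IH|n IH].
- exact: scales_trace_id.
- by rewrite intS -apowS exprzDr ?unitfE // expr1z; apply: scales_trace_comp.
- have -> : - n.+1%:Z = - n%:Z - 1 by rewrite intS opprD addrC.
  rewrite -apowV addrC exprzDr ?unitfE // exprN1.
  by apply: scales_trace_comp => //; apply: scales_trace_inv.
Qed.

(** If the commutation [eta_eps(S)] is [c] times the trivial one, then [S]
    multiplies traces by [c / eps]. *)
Lemma scales_trace_eta S (eps c : k) eta (FS : fcomp F S = fcomp S F) :
  eps != 0 -> @is_eta k C F S eps eta ->
  (forall X, eta X = c *: eqnat FS X) -> scales_trace S (c / eps).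
Proof.
move=> eps0 [_ etaT] etaE; split=> // Y v w e.
have eta_w : eta Y \oc w = c *: fmap S v.
  rewrite etaE compZl; congr (_ *: _); apply: arr_inj.
  by rewrite arr_eqnatl.
have := etaT Y w; rewrite eta_w (scalable_linear (@fmap_lin _ _ _ (ainv S) _ _)).
rewrite compZr compZl TrZ.
set u := (X in _ * Tr F Y X) => eu; have eT : Tr F Y v = Tr F Y u.
  apply/esym/arr_Tr/(etrans (arr_eqhomr _ _))/(etrans (arr_eqhoml _ _)).
  exact: (arr_functor v (afunK S)).
by apply: (mulfI eps0); rewrite -eu eT mulrA mulrCA divff // mulr1.
Qed.

End TraceScaling.

(** * Associative forms with a Nakayama map *)

Section NakayamaForm.
Variables (k : fieldType) (A : kalg k) (B : {biscalar A}) (mu : A -> A).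

(** A bijection [mu] that is Nakayama for an associative form is automatically
    an algebra automorphism, and nondegeneracy on one side suffices. *)
Lemma frobenius_of_nakayama :
  (forall x y z : A, B (x \*a y) z = B x (y \*a z)) ->
  (forall y : A, (forall x, B x y = 0) -> y = 0) ->
  linear mu -> bijective mu -> (forall x y : A, B x y = B (mu y) x) ->
  frobenius B mu.
Proof.
move=> BA ndr mu_lin mu_bij naka.
have ndl x : (forall y, B x y = 0) -> x = 0.
  move=> Bx0; apply: ndr => z; have [nu _ nuK] := mu_bij.
  by rewrite -(nuK z) -naka.
have injB u v : (forall z, B u z = B v z) -> u = v.
  move=> Buv; apply/eqP; rewrite -subr_eq0; apply/eqP/ndl => z.
  by rewrite linearBl Buv subrr.
split=> // [|x y]; apply: injB => z.
- by rewrite -naka -[in LHS](kmul1x z) BA (kmulx1 z) -[z in RHS]kmul1x -BA kmul1x.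
(* (mu (x y), z) = (z x, y) = (mu y, z x) = (mu x, mu y z) = (mu x mu y, z) *)
- by rewrite -naka -BA naka -BA naka BA.
Qed.

End NakayamaForm.

(** * The bigrading of the graded endomorphism algebra *)

Section Bigrading.
Variables (k : fieldType) (C : gtriangulated k) (X : C).

Lemma endalg_bigrading :
  bigrading (A := endalg X) (fun n => range (@hinj k C X n)).
Proof.
have hinjE (s : seq (int * int)) (c : int * int -> endalg X) n : uniq s ->
    (forall m, range (@hinj k C X m) (c m)) -> n \in s ->
    (\sum_(m <- s) c m : endmod X) n = c n n.
  move=> us cP sn; rewrite dcoef_sum (bigD1_seq n) //= big1 ?addr0 // => m mn.
  by have [f _ <-] := cP m; rewrite dinj_off.
split.
- move=> n a _ _ [f _ <-] [g _ <-]; exists (a *: f + g) => //.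
  by rewrite hinj_lin.
- by move=> n; exists 0 => //; rewrite hinj0.
- move=> x; have [s us xs] := dirsum_suppP x.
  exists s, (fun n => hinj (x n)); split; first by move=> n; exists (x n).
  exact: dirsumE us xs.
- move=> s c us cP c0 n sn; have := hinjE s c n us cP sn.
  have [f _ <-] := cP n; rewrite c0 dinj_diag dcoef0 => <-.
  by rewrite hinj0.
- by exists (deg0 (idm X)).
- move=> m n _ _ [f _ <-] [g _ <-]; exists (gcast (addrC n m) (f \*g g)) => //.
  by rewrite hinj_gcast [RHS]emul_hinj.
Qed.

End Bigrading.

(** * The Frobenius form *)

Section Form.
Variables (k : fieldType) (C : gtriangulated k) (F : serre C)
  (Phi : functor C C) (d l : int) (s t : k) (H : standing F Phi d l s t)
  (X : C) (phi : iso X (Phi X)).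
Implicit Types (m n : int * int) (x y : endalg X).

(** The scalar [(-s)^i t^j] in bidegree [(i, j)]. *)
Definition nak_scalar n : k := (- s) ^ n.1 * t ^ n.2.

Lemma scales_trace_sh n : scales_trace F (sh C n) (nak_scalar n).
Proof.
apply: scales_trace_comp; apply: scales_trace_pow.
- by rewrite oppr_eq0 (st_s H).
- have := scales_trace_eta _ (st_etaP H) (st_etaE H).
  by rewrite oppr_eq0 oner_eq0 invrN1 mulrN1; apply.
- exact: st_t H.
- have := scales_trace_eta _ (st_thetaP H) (st_thetaE H).
  by rewrite oner_eq0 divr1; apply.
Qed.

(** The linear form on the component of degree [(d, l)] that defines the
    Frobenius form: [h |-> Tr (phi * h)]. *)
Definition ctrace (h : ghom (d, l) X X) : k :=
  Tr F X (eqnat (esym (st_serre H)) X \oc (fmap (sh C (d, l)) phi \oc h)).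

Lemma ctraceZ a h : ctrace (a *: h) = a * ctrace h.
Proof. by rewrite /ctrace !compZr TrZ. Qed.

Lemma ctrace_lin a h h' : ctrace (a *: h + h') = a * ctrace h + ctrace h'.
Proof. by rewrite /ctrace !comp_linr TrD TrZ. Qed.

Lemma ctrace0 : ctrace 0 = 0.
Proof. by rewrite -(scale0r (0 : ghom (d, l) X X)) ctraceZ mul0r. Qed.

Lemma gcast0 m n (e : m = n) : gcast e (0 : ghom m X X) = 0.
Proof. by case: _ / e; rewrite /gcast /= comp1m. Qed.

Lemma ctraceE (h : ghom (d, l) X X) (w : hom X (F X)) :
  arr w = arr (fmap (sh C (d, l)) phi \oc h) -> ctrace h = Tr F X w.
Proof. by move=> e; apply: arr_Tr; rewrite e; apply: arr_eqhoml. Qed.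

(** The product of [x] and [y] is projected to degree [(d, l)] and traced. *)
Definition frob_form x y : k := ctrace ((x \*a y) (d, l)).

Lemma frob_form_biscalar : bilinear_for *%R *%R frob_form.
Proof.
split=> [y|x] a u v; rewrite /frob_form ?kmul_linl ?kmul_linr;
  by rewrite dcoefD dcoefZ ctrace_lin.
Qed.

HB.instance Definition _ := bilinear_isBilinear.Build k (endalg X) (endalg X) k
  *%R *%R frob_form frob_form_biscalar.

(** Pairing with [f] of degree [n] sees only the complementary component. *)
Lemma frob_form_hinjl m n (e : m + n = (d, l)) (f : ghom n X X) y :
  frob_form (hinj f) y = ctrace (gcast e (f \*g y m)).
Proof.
elim/dirsum_ind: y => [|y y' IH IH'|m' g].
- by rewrite linear0r dcoef0 gcomp_linr0 gcast0 ctrace0.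
- rewrite dcoefD -[y m]scale1r gcomp_linr /gcast comp_linr ctrace_lin.
  by rewrite mul1r [LHS]linearDr; congr (_ + _).
rewrite /frob_form [_ \*a _]emul_hinj.
have [mm|mm] := eqVneq m' m.
  by case: _ / mm e => e; rewrite dinj_diag -(hinj_gcast e) dinj_diag.
rewrite (dinj_off _ mm) gcomp_linr0 gcast0 ctrace0 dinj_off ?ctrace0 //.
by rewrite -e (inj_eq (addIr _)).
Qed.

Lemma serre_sh_ob m n : m + n = (d, l) -> sh C m (sh C n (Phi X)) = F X.
Proof.
by move=> e; have := feq_ob (shD m n) (Phi X); rewrite e (st_serre H).
Qed.

(** The morphism [Sigma^m (Sigma^n phi o f)], seen as a morphism into
    [F X].  The form pairs [f] with [g] as [Tr (frob_dual f o g)]. *)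
Definition frob_dual m n (e : m + n = (d, l)) (f : ghom n X X) :
    hom (sh C m X) (F X) :=
  eqhom (serre_sh_ob e) \oc fmap (sh C m) (fmap (sh C n) phi \oc f).

Lemma ctrace_gcomp m n (e : m + n = (d, l)) (f : ghom n X X) (g : ghom m X X) :
  ctrace (gcast e (f \*g g)) = Tr F X (frob_dual e f \oc g).
Proof.
apply: ctraceE; rewrite /frob_dual fmapM -!compA arr_eqhoml.
apply: arr_comp; last by rewrite arr_shD e.
by rewrite arr_gcast arr_gcomp.
Qed.

(** Every morphism [Sigma^m X -> F X] comes from a homogeneous element. *)
Lemma frob_dual_surj m n (e : m + n = (d, l)) (h : hom (sh C m X) (F X)) :
  exists f, frob_dual e f = h.
Proof.
have [f0 f0E] := sh_full (eqhom (esym (serre_sh_ob e)) \oc h).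
exists (iso_inv (fmap_iso (sh C n) phi) \oc f0).
rewrite /frob_dual compA (iso_vK (fmap_iso (sh C n) phi)) comp1m f0E.
by rewrite compA eqhomM eqhom_id comp1m.
Qed.

(** By Serre duality, [alpha] being injective. *)
Lemma frob_form_ndr y : (forall x, frob_form x y = 0) -> y = 0.
Proof.
move=> y0; apply: dirsumP => m; apply: (bij_inj (alpha_bij F X (sh C m X))).
rewrite linear0; apply/lfunP => h; rewrite zero_lfunE.
have e : m + ((d, l) - m) = (d, l) by rewrite addrC subrK.
have [f <-] := frob_dual_surj e h.
have -> : alpha F X (sh C m X) (y m) (frob_dual e f)
        = Tr F X (frob_dual e f \oc y m) by rewrite /Tr -alpha_natr compm1.
by rewrite -ctrace_gcomp -frob_form_hinjl.
Qed.

(** * The Nakayama automorphism *)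

(** The component [g |-> (-s)^i t^j phi^-1 * Phi(g) * phi] of the Nakayama
    automorphism in degree [n = (i, j)]. *)
Definition nak_comp n (g : ghom n X X) : ghom n X X :=
  nak_scalar n *:
    (iso_inv (fmap_iso (sh C n) phi) \oc (gfmap H g \oc phi)).

Lemma nak_comp_lin n : linear (@nak_comp n).
Proof.
move=> a u v; rewrite /nak_comp /gfmap fmap_lin !(comp_linr, comp_linl).
by rewrite scalerDr !scalerA mulrC.
Qed.

HB.instance Definition _ n := GRing.isLinear.Build k (ghom n X X) (ghom n X X)
  *:%R (@nak_comp n) (@nak_comp_lin n).

Lemma nakayama_fin x : finite_set [set n | nak_comp (x n) != 0].
Proof.
apply: sub_finite_set (dcoef_fin x) => n /=.
by apply: contra_neq => ->; rewrite linear0.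
Qed.

(** The Nakayama automorphism acts on each homogeneous component separately. *)
Definition nakayama x : endalg X := DirSum (nakayama_fin x).

Lemma nakayama_lin : linear nakayama.
Proof. by move=> a x y; apply: dirsumP => n; exact: nak_comp_lin. Qed.

Lemma nakayama_hinj n (g : ghom n X X) : nakayama (hinj g) = hinj (nak_comp g).
Proof.
apply: dirsumP => m; rewrite -[LHS]/(nak_comp (hinj g m)).
have [<-|nm] := eqVneq n m; first by rewrite !dinj_diag.
by rewrite !(dinj_off _ nm) linear0.
Qed.

Lemma arr_gfmap n (g : ghom n X X) : arr (gfmap H g) = arr (fmap Phi g).
Proof. exact: arr_eqhoml. Qed.

(** The Nakayama identity on homogeneous elements: moving [g] around the trace
    by naturality of the Serre isomorphisms turns it into [F g] on
    the other side, and the resulting composite is a translate by [Sigma^m],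
    whose trace contributes the scalar. *)
Lemma ctrace_nak m n (e : m + n = (d, l)) (e' : n + m = (d, l))
    (f : ghom n X X) (g : ghom m X X) :
  ctrace (gcast e (f \*g g)) = ctrace (gcast e' (nak_comp g \*g f)).
Proof.
pose v : hom X (F X) := eqhom (serre_sh_ob e') \oc
  (fmap (sh C n) (gfmap H g \oc phi) \oc f).
have vE : arr v = arr (fmap (sh C n) (gfmap H g \oc phi) \oc f).
  exact: arr_eqhoml.
have [_ TrS] := scales_trace_sh m.
rewrite ctrace_gcomp Tr_comp (TrS _ v); last first.
  rewrite (arr_fmap _ vE) (fmapM (sh C n) (gfmap H g)) -compA.
  rewrite (fmapM (sh C m) (fmap (sh C n) (gfmap H g))).
  apply: arr_comp; first exact: arr_eqhoml.
  rewrite arr_shD e (arr_fmap _ (arr_gfmap g)).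
  exact: (arr_functor g (st_serre H)).
set g' := iso_inv (fmap_iso (sh C m) phi) \oc (gfmap H g \oc phi).
have -> : gcast e' (nak_comp g \*g f)
        = nak_scalar m *: gcast e' ((g' : ghom m X X) \*g f).
  by rewrite /gcast /gcomp (scalable_linear (@fmap_lin _ _ _ _ _ _)) compZl !compZr.
rewrite ctraceZ; congr (_ * _); apply/esym/ctraceE; rewrite vE.
have -> : gfmap H g \oc phi = fmap (sh C m) phi \oc g'.
  by rewrite /g' compA (iso_vK (fmap_iso (sh C m) phi)) comp1m.
rewrite fmapM -compA; apply: arr_comp; last by rewrite arr_shD e'.
by rewrite arr_gcast arr_gcomp.
Qed.

Lemma frob_form_off m n (f : ghom m X X) (g : ghom n X X) :
  m + n <> (d, l) -> frob_form (hinj f) (hinj g) = 0.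
Proof.
move=> /eqP mn; rewrite /frob_form [_ \*a _]emul_hinj dinj_off ?ctrace0 //.
by rewrite addrC.
Qed.

Lemma frob_form_hinj m n (e : m + n = (d, l)) (f : ghom n X X)
    (g : ghom m X X) :
  frob_form (hinj f) (hinj g) = ctrace (gcast e (f \*g g)).
Proof. by rewrite (frob_form_hinjl e) dinj_diag. Qed.

Lemma nakayama_frob_form x y : frob_form x y = frob_form (nakayama y) x.
Proof.
have nakD u v : nakayama (u + v) = nakayama u + nakayama v.
  by rewrite -[u]scale1r nakayama_lin !scale1r.
have nak0 : nakayama 0 = 0 by apply: dirsumP => n; exact: linear0.
elim/dirsum_ind: x => [|x x' IH IH'|n f].
- by rewrite linear0l linear0r.
- by rewrite [LHS]linearDl [RHS]linearDr; congr (_ + _).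
elim/dirsum_ind: y => [|y y' IH IH'|m g].
- by rewrite nak0 linear0l linear0r.
- by rewrite nakD [LHS]linearDr [RHS]linearDl; congr (_ + _).
rewrite -/(hinj f) -/(hinj g) nakayama_hinj.
have [e|ne] := eqVneq (m + n) (d, l); last first.
  by rewrite !frob_form_off //; apply/eqP; rewrite // addrC.
have e' : n + m = (d, l) by rewrite addrC.
by rewrite (frob_form_hinj e) (frob_form_hinj e') (ctrace_nak e e').
Qed.

(** Each component is injective by nondegeneracy, hence bijective because the
    homogeneous components are finite-dimensional. *)
Lemma nakayama_bij : bijective nakayama.
Proof.
pose N n : 'End(ghom n X X) := linfun (@nak_comp n).
have kerN n : lker (N n) == 0%VS.
  apply/lker0P => u v; rewrite !lfunE => uv.
  suff : hinj u - hinj v = 0 :> endalg X.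
    by move/subr0_eq/(congr1 (fun x : endmod X => x n)); rewrite !dinj_diag.
  have -> : hinj u - hinj v = hinj (u - v) by rewrite /hinj raddfB.
  apply: frob_form_ndr => x; rewrite nakayama_frob_form nakayama_hinj.
  by rewrite raddfB /= uv subrr hinj0 linear0l.
have fin x : finite_set [set n | ((N n)^-1)%VF (x n) != 0].
  apply: sub_finite_set (dcoef_fin x) => n /=.
  by apply: contra_neq => ->; rewrite linear0.
exists (fun x : endmod X => DirSum (fin x)) => x; apply: dirsumP => n.
- have := lker0_lfunK (kerN n) (x n); rewrite [N n _]lfunE; exact.
- have := lker0_lfunVK (kerN n) (x n); rewrite [N n _]lfunE; exact.
Qed.

Lemma frobenius_endalg : frobenius frob_form nakayama.
Proof.
apply: frobenius_of_nakayama.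
- by move=> x y z; rewrite /= /frob_form kmulA.
- exact: frob_form_ndr.
- exact: nakayama_lin.
- exact: nakayama_bij.
- exact: nakayama_frob_form.
Qed.

End Form.

Theorem theorem2p7 (k : closedFieldType) (C : gtriangulated k) (F : serre C)
    (Phi : functor C C) (d l : int) (s t : k) (H : standing F Phi d l s t)
    (X : C) (phi : iso X (Phi X)) :
  exists (B : {biscalar (endalg X)}) (mu : endalg X -> endalg X),
    [/\ bigrading (A := endalg X) (fun n => range (@hinj k C X n)),
        frobenius B mu,
        (forall (i j : int) (g : ghom (i, j) X X)
            (f : ghom (d - i, l - j) X X),
          B (hinj f) (hinj g)
            = Tr F X (eqnat (esym (st_serre H)) X
                \oc gcast (deg_compl0 i j d l) (deg0 phi \*g (f \*g g)))
          /\
          B (hinj f) (hinj g)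
            = Tr F X (eqnat (esym (st_serre H)) X
                \oc (fmap (sh C (d, l)) phi
                \oc (eqnat (sh_compl C i j d l) X
                \oc (fmap (sh C (i, j)) f \oc g))))),
        (forall (m n : int * int) (f : ghom m X X) (g : ghom n X X),
          m + n <> (d, l) -> B (hinj f) (hinj g) = 0)
      & (forall (i j : int) (g : ghom (i, j) X X),
          mu (hinj g)
            = hinj (((- s) ^ i * t ^ j) *:
                gcast (deg_conj (i, j))
                  (deg0 (iso_inv phi) \*g (gfmap H g \*g deg0 phi)))
          /\
          mu (hinj g)
            = hinj (((- s) ^ i * t ^ j) *:
                (iso_inv (fmap_iso (sh C (i, j)) phi)
                  \oc (gfmap H g \oc phi) : ghom (i, j) X X)))].
Proof.
exists (frob_form H phi), (nakayama H phi); split.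
- exact: endalg_bigrading.
- exact: frobenius_endalg.
- move=> i j g f.
  have formE := frob_form_hinj H phi (deg_compl i j d l) f g.
  split; apply: (etrans formE); apply: ctraceE.
  + rewrite arr_eqnatl arr_gcast arr_gcomp.
    apply: arr_comp; first by rewrite arr_gcast.
    by apply: arr_functor; rewrite deg_compl.
  + rewrite arr_eqnatl; apply: arr_comp => //.
    by rewrite arr_eqnatl arr_gcast arr_gcomp.
- by move=> m n f g; apply: frob_form_off.
- move=> i j g; rewrite nakayama_hinj; split=> //.
  congr (hinj (_ *: _)); apply: arr_inj; rewrite arr_gcast arr_gcomp.
  apply: arr_comp; first by rewrite arr_gcomp.
  by apply: arr_functor; rewrite add0r.
Qed.
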